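(* Let $\mathbb{F}$ be a field, $G$ a group, and let $\varepsilon:\mathbb{N}\to G$ define a $G$-grading on $\mathrm{UT}$. If $\varepsilon$ is not eventually incomplete, then $\mathrm{Id}_G(\mathrm{UT},\varepsilon)=0$.
   Context: $\mathbb{N}=\{1,2,\ldots\}$. $\mathrm{UT}$ is the associative $\mathbb{F}$-algebra with basis $\{e_{ij}\mid 1\le i\le j\}$ ($i,j\in\mathbb{N}$) and product $e_{ij}e_{k\ell}=\delta_{jk}e_{i\ell}$. A map $\varepsilon:\mathbb{N}\to G$ defines a $G$-grading on $\mathrm{UT}$ in which each $e_{ij}$ is homogeneous of degree $\varepsilon(i)\varepsilon(i+1)\cdots\varepsilon(j-1)$ (so $\deg_G e_{i,i+1}=\varepsilon(i)$ and $\deg_G e_{ii}=1$). For $i\in\mathbb{N}$ let $R_i=e_{ii}J(\mathrm{UT})=\mathrm{Span}\{e_{ij}\mid j>i\}$, and $\mathrm{Supp}\,R_i=\{\deg_G e_{ij}\mid j>i\}$. The grading $\varepsilon$ is eventually incomplete if there exists $N\in\mathbb{N}$ such that $\mathrm{Supp}\,R_i\ne G$ for all $i\ge N$. $\mathbb{F}\langle X^G\rangle$ is the free associative unital algebra on variables $x_i^{(g)}$ ($g\in G$, $i\in\mathbb{N}$), with $\deg_G x_i^{(g)}=g$. $\mathrm{Id}_G(\mathrm{UT},\varepsilon)$ is the set of all $f(x_1^{(g_1)},\ldots,x_m^{(g_m)})\in\mathbb{F}\langle X^G\rangle$ such that $f(a_1,\ldots,a_m)=0$ for all $a_i$ in the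 homogeneous component of degree $g_i$ of $\mathrm{UT}$ with the grading defined by $\varepsilon$ (constant terms are evaluated in the unitization of $\mathrm{UT}$). *)

(* Defs.v *)
From HB Require Import structures.
From mathcomp Require Import all_boot all_algebra finmap.
From mathcomp.multinomials Require Import monalg.

Set Implicit Arguments.
Unset Strict Implicit.
Unset Printing Implicit Defensive.

Import GRing.Theory.

Local Open Scope ring_scope.

(* The index set {1, 2, ...} is represented by [nat], i.e. shifted to start   *)
(* at 0.                                                                      *)

Definition ut_index := {p : nat * nat | (p.1 <= p.2)%N}.
HB.instance Definition _ := Choice.on ut_index.

(* Finitely supported families of coefficients on the basis e_{ij}, i <= j;    *)
(* the product is [ut_mul] below.                                             *)
Definition UT (F : fieldType) := {malg F[ut_index]}.
HB.instance Definition _ (F : fieldType) := GRing.Lmodule.on (UT F).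

Section UTAlgebra.
Variable F : fieldType.
Implicit Types (p q r : ut_index) (u v w : UT F).

(* The matrix unit e_{ij}, with junk value 0 when j < i.                      *)
Definition ut_unit (i j : nat) : UT F :=
  if insub (i, j) is Some p then << p >> else 0.

Definition ut_mulb p q : UT F :=
  if (val p).2 == (val q).1 then ut_unit (val p).1 (val q).2 else 0.

(* Bilinear extension of e_{ij} e_{kl} = delta_{jk} e_{il}.                   *)
Definition ut_mul u v : UT F :=
  \sum_(p <- msupp u) \sum_(q <- msupp v) (u@_p * v@_q) *: ut_mulb p q.

Lemma ut_mulEw (A B : {fset ut_index}) u v :
    (msupp u `<=` A)%fset -> (msupp v `<=` B)%fset ->
  ut_mul u v = \sum_(p <- A) \sum_(q <- B) (u@_p * v@_q) *: ut_mulb p q.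
Proof.
move=> sA sB; rewrite /ut_mul (big_fset_incl _ sA) /=; last first.
  move=> p _ /mcoeff_outdom up0; rewrite big1 // => q _.
  by rewrite up0 mul0r scale0r.
apply: eq_bigr => p _; rewrite (big_fset_incl _ sB) //= => q _.
by move=> /mcoeff_outdom ->; rewrite mulr0 scale0r.
Qed.

Lemma ut_mulDl : left_distributive ut_mul +%R.
Proof.
move=> u v w; set A := (msupp u `|` msupp v `|` msupp (u + v))%fset.
have sw := fsubset_refl (msupp w).
rewrite !(@ut_mulEw A (msupp w)) //.
- rewrite -big_split /=; apply: eq_bigr => p _.
  rewrite -big_split /=; apply: eq_bigr => q _.
  by rewrite mcoeffD mulrDl scalerDl.
- by rewrite /A -fsetUA fsetUCA fsubsetUl.
- by rewrite /A -fsetUA fsubsetUl.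
- by rewrite /A fsubsetUr.
Qed.

Lemma ut_mulDr : right_distributive ut_mul +%R.
Proof.
move=> w u v; set A := (msupp u `|` msupp v `|` msupp (u + v))%fset.
have sw := fsubset_refl (msupp w).
rewrite !(@ut_mulEw (msupp w) A) //.
- rewrite -big_split /=; apply: eq_bigr => p _.
  rewrite -big_split /=; apply: eq_bigr => q _.
  by rewrite mcoeffD mulrDr scalerDl.
- by rewrite /A -fsetUA fsetUCA fsubsetUl.
- by rewrite /A -fsetUA fsubsetUl.
- by rewrite /A fsubsetUr.
Qed.

Lemma ut_scaleAl c u v : c *: ut_mul u v = ut_mul (c *: u) v.
Proof.
rewrite (@ut_mulEw (msupp u) (msupp v) (c *: u)) ?fsubset_refl ?msuppZ_le //.
rewrite scaler_sumr; apply: eq_bigr => p _.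
rewrite scaler_sumr; apply: eq_bigr => q _.
by rewrite mcoeffZ scalerA mulrA.
Qed.

Lemma ut_scaleAr c u v : c *: ut_mul u v = ut_mul u (c *: v).
Proof.
rewrite (@ut_mulEw (msupp u) (msupp v) u (c *: v)) ?fsubset_refl ?msuppZ_le //.
rewrite scaler_sumr; apply: eq_bigr => p _.
rewrite scaler_sumr; apply: eq_bigr => q _.
by rewrite mcoeffZ scalerA mulrCA.
Qed.

Lemma ut_mul0l u : ut_mul 0 u = 0.
Proof. by rewrite /ut_mul msupp0 big_seq_fset0. Qed.

Lemma ut_mul0r u : ut_mul u 0 = 0.
Proof. by rewrite /ut_mul msupp0 big1 // => p _; rewrite big_seq_fset0. Qed.

Lemma ut_unitE p : ut_unit (val p).1 (val p).2 = << p >>.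
Proof. by rewrite /ut_unit -surjective_pairing valK. Qed.

Lemma ut_unitP i j (le_ij : (i <= j)%N) :
  ut_unit i j = << (exist _ (i, j) le_ij : ut_index) >>.
Proof. exact: (ut_unitE (exist _ (i, j) le_ij)). Qed.

Lemma ut_mul_basis p q : ut_mul << p >> << q >> = ut_mulb p q.
Proof.
by rewrite (@ut_mulEw [fset p]%fset [fset q]%fset) ?msuppU_le //;
   rewrite !big_seq_fset1 !mcoeffUU mulr1 scale1r.
Qed.

Lemma ut_mul_unit i j k l : (i <= j)%N -> (k <= l)%N ->
  ut_mul (ut_unit i j) (ut_unit k l) = if j == k then ut_unit i l else 0.
Proof. by move=> ij kl; rewrite (ut_unitP ij) (ut_unitP kl) ut_mul_basis. Qed.

Lemma ut_mulA_basis p q r :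
  ut_mul << p >> (ut_mul << q >> << r >>)
    = ut_mul (ut_mul << p >> << q >>) << r >>.
Proof.
rewrite -!ut_unitE; case: p q r => [[i j] /= ij] [[k l] /= kl] [[m n] /= mn].
rewrite (ut_mul_unit kl mn) (ut_mul_unit ij kl).
case: (eqVneq j k) => [ejk|njk]; case: (eqVneq l m) => [elm|nlm].
- have kn : (k <= n)%N by rewrite (leq_trans kl) // elm.
  have il : (i <= l)%N by rewrite (leq_trans ij) // ejk.
  by rewrite (ut_mul_unit ij kn) (ut_mul_unit il mn) ejk elm !eqxx.
- have il : (i <= l)%N by rewrite (leq_trans ij) // ejk.
  by rewrite (ut_mul_unit il mn) (negPf nlm) (ut_mul0r (ut_unit i j)).
- have kn : (k <= n)%N by rewrite (leq_trans kl) // elm.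
  by rewrite (ut_mul_unit ij kn) (negPf njk) (ut_mul0l (ut_unit m n)).
- by rewrite (ut_mul0r (ut_unit i j)) (ut_mul0l (ut_unit m n)).
Qed.

Lemma ut_ind (P : UT F -> Prop) :
    P 0 -> (forall u v, P u -> P v -> P (u + v)) ->
    (forall c u, P u -> P (c *: u)) -> (forall p, P << p >>) ->
  forall u, P u.
Proof.
move=> P0 PD PZ Pb u; rewrite (monalgE u); elim/big_ind: _ => // p _.
suff -> : << u@_p *g p >> = u@_p *: << p >> :> UT F by exact: PZ.
apply/malgP => q.
rewrite mcoeffZ.
rewrite mcoeffU.
rewrite mcoeffU.
by rewrite mulrnAr mulr1.
Qed.

Lemma ut_mulA : associative ut_mul.
Proof.
move=> u v w; elim/ut_ind: u => [|u u' IH IH'|c u IH|p].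
- by rewrite (ut_mul0l (ut_mul v w)) (ut_mul0l v) (ut_mul0l w).
- by rewrite !ut_mulDl IH IH'.
- by rewrite -!ut_scaleAl IH.
elim/ut_ind: v => [|v v' IH IH'|c v IH|q].
- by rewrite (ut_mul0l w) (ut_mul0r << p >>) (ut_mul0l w).
- by rewrite !(ut_mulDl, ut_mulDr) IH IH'.
- by rewrite -!(ut_scaleAl, ut_scaleAr) IH.
elim/ut_ind: w => [|w w' IH IH'|c w IH|r].
- by rewrite (ut_mul0r << q >>) (ut_mul0r << p >>) ut_mul0r.
- by rewrite !ut_mulDr IH IH'.
- by rewrite -!ut_scaleAr IH.
exact: ut_mulA_basis.
Qed.

End UTAlgebra.

(* The unitization F + A of an algebra A, with product                        *)
(* (a + u) (b + v) = a b + (a v + b u + u v)                                  *)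

Section Unitization.
Variables (F : fieldType) (A : lmodType F) (mul : A -> A -> A).

Definition unitz_one : F^o * A := (1, 0).

Definition unitz_mul (x y : F^o * A) : F^o * A :=
  (x.1 * y.1, x.1 *: y.2 + y.1 *: x.2 + mul x.2 y.2).

Hypotheses (mulA : associative mul)
  (mulDl : left_distributive mul +%R)
  (mulDr : right_distributive mul +%R)
  (scaleAl : forall (c : F) u v, c *: mul u v = mul (c *: u) v)
  (scaleAr : forall (c : F) u v, c *: mul u v = mul u (c *: v)).

Let mul0x u : mul 0 u = 0.
Proof. by have := scaleAl 0 0 u; rewrite !scale0r. Qed.

Let mulx0 u : mul u 0 = 0.
Proof. by have := scaleAr 0 u 0; rewrite !scale0r. Qed.

Lemma unitz_mulA : associative unitz_mul.
Proof.
move=> [a u] [b v] [c w]; rewrite /unitz_mul /=; congr (_, _).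
  exact: mulrA.
rewrite !mulDl !mulDr -!scaleAl -!scaleAr !scalerDr !scalerA mulA.
rewrite [c * a]mulrC [c * b]mulrC -!addrA; do 2!congr (_ + _).
rewrite addrCA; congr (_ + _).
by rewrite [b *: mul u w + (_ + _)]addrCA addrCA.
Qed.

Lemma unitz_mul1l : left_id unitz_one unitz_mul.
Proof.
move=> [a u]; rewrite /unitz_mul /=; congr (_, _); first exact: mul1r.
by rewrite scale1r scaler0 mul0x !addr0.
Qed.

Lemma unitz_mul1r : right_id unitz_one unitz_mul.
Proof.
move=> [a u]; rewrite /unitz_mul /=; congr (_, _); first exact: mulr1.
by rewrite scale1r scaler0 mulx0 addr0 add0r.
Qed.

Lemma unitz_mulDl : left_distributive unitz_mul +%R.
Proof.
move=> [a u] [b v] [c w]; rewrite /unitz_mul /=; congr (_, _).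
  exact: mulrDl.
by rewrite /= scalerDl scalerDr mulDl [RHS]addrACA; congr (_ + _);
   exact: addrACA.
Qed.

Lemma unitz_mulDr : right_distributive unitz_mul +%R.
Proof.
move=> [a u] [b v] [c w]; rewrite /unitz_mul /=; congr (_, _).
  exact: mulrDr.
by rewrite /= scalerDl scalerDr mulDr [RHS]addrACA; congr (_ + _);
   exact: addrACA.
Qed.

Lemma unitz_1neq0 : unitz_one != 0.
Proof. by apply/eqP => -[] /eqP; rewrite oner_eq0. Qed.

Lemma unitz_scaleAl (c : F) x y :
  c *: unitz_mul x y = unitz_mul (c *: x) y.
Proof.
case: x y => [a u] [b v]; rewrite /unitz_mul /=; congr (_, _).
  exact: mulrA.
by rewrite /= !scalerDr -scaleAl !scalerA [b * c]mulrC.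
Qed.

Lemma unitz_scaleAr (c : F) x y :
  c *: unitz_mul x y = unitz_mul x (c *: y).
Proof.
case: x y => [a u] [b v]; rewrite /unitz_mul /=; congr (_, _).
  exact: mulrCA.
by rewrite /= !scalerDr -scaleAr !scalerA [a * c]mulrC.
Qed.

End Unitization.

Definition UT1 (F : fieldType) := (F^o * UT F)%type.

Section UT1Algebra.
Variable F : fieldType.

HB.instance Definition _ := GRing.Lmodule.on (UT1 F).

HB.instance Definition _ := GRing.Zmodule_isNzRing.Build (UT1 F)
  (unitz_mulA (@ut_mulA F) (@ut_mulDl F) (@ut_mulDr F)
              (@ut_scaleAl F) (@ut_scaleAr F))
  (unitz_mul1l (@ut_scaleAl F)) (unitz_mul1r (@ut_scaleAr F))
  (unitz_mulDl (@ut_mulDl F)) (unitz_mulDr (@ut_mulDr F))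
  (unitz_1neq0 (UT F)).

HB.instance Definition _ := GRing.Lmodule_isLalgebra.Build F (UT1 F)
  (unitz_scaleAl (@ut_scaleAl F)).

HB.instance Definition _ := GRing.Lalgebra_isAlgebra.Build F (UT1 F)
  (unitz_scaleAr (@ut_scaleAr F)).

Definition ut1_inj (u : UT F) : UT1 F := (0, u).

End UT1Algebra.

Section Grading.
Variables (F : fieldType) (G : groupType) (eps : nat -> G).

(* The degree of e_{ij}; the factors are multiplied in increasing order.      *)
Definition ut_deg (i j : nat) : G := (\prod_(i <= k < j) eps k)%g.

(* Membership in the homogeneous component Span{e_{ij} | deg e_{ij} = g}.     *)
Definition ut_homog (g : G) (u : UT F) : Prop :=
  forall p, p \in msupp u -> ut_deg (val p).1 (val p).2 = g.

(* g lies in Supp R_i, where R_i = e_{ii} J(UT) = Span{e_{ij} | j > i}.        *)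
Definition in_supp_R (i : nat) (g : G) : Prop :=
  exists2 j, (i < j)%N & ut_deg i j = g.

Definition eventually_incomplete : Prop :=
  exists N, forall i, (N <= i)%N -> ~ (forall g, in_supp_R i g).

Lemma ut_degM i j k : (i <= j)%N -> (j <= k)%N ->
  (ut_deg i j * ut_deg j k)%g = ut_deg i k.
Proof. by move=> ij jk; rewrite /ut_deg -big_cat_nat. Qed.

End Grading.

Lemma ut_homog_unit (F : fieldType) (G : groupType) (eps : nat -> G) i j :
  ut_homog eps (ut_deg eps i j) (ut_unit F i j).
Proof.
move=> p; rewrite /ut_unit; case: insubP => [q _ eq|_]; last by rewrite msupp0.
by move/(fsubsetP msuppU_le); rewrite in_fset1 => /eqP ->; rewrite eq.
Qed.

Lemma ut_homogM (F : fieldType) (G : groupType) (eps : nat -> G) g h u v :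
    ut_homog eps g u -> ut_homog eps h v ->
  ut_homog eps (g * h)%g (ut_mul u v : UT F).
Proof.
move=> hu hv r; apply: contraTeq => ne; rewrite -mcoeff_eq0 /ut_mul.
rewrite raddf_sum big_seq big1 /= // => p pu.
rewrite raddf_sum big_seq big1 /= // => q qv.
rewrite mcoeffZ /ut_mulb; case: eqP => [e|_]; last by rewrite mcoeff0 mulr0.
have: (g * h)%g = ut_deg eps (val p).1 (val q).2.
  by rewrite -(hu _ pu) -(hv _ qv) e ut_degM // -?e ?(valP p) // e (valP q).
move=> egh; suff -> : (ut_unit F (val p).1 (val q).2)@_r = 0 by rewrite mulr0.
apply: mcoeff_outdom; apply/negP => /ut_homog_unit - /(_ _ eps) er.
by move: ne; rewrite er egh eqxx.
Qed.

(* The monoid algebra of the free monoid on the letters (g, i), where (g, i)  *)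
(* stands for the variable x_i^(g) of degree g.                               *)
Definition free_algebra (F : fieldType) (G : groupType) :=
  {malg F[{fmonom (G * nat)%type}]}.
HB.instance Definition _ (F : fieldType) (G : groupType) :=
  GRing.Lalgebra.on (free_algebra F G).

Section Identities.
Variables (F : fieldType) (G : groupType).

(* The value of f under x_i^(g) |-> a g i, computed in the unitization.       *)
Definition ut_eval (a : G -> nat -> UT F) (f : free_algebra F G) : UT1 F :=
  mmap (in_alg (UT1 F))
       (fun m : {fmonom (G * nat)%type} => \prod_(x <- m) ut1_inj (a x.1 x.2))
       f.

Definition graded_identity (eps : nat -> G) (f : free_algebra F G) : Prop :=
  forall a : G -> nat -> UT F,
    (forall g i, ut_homog eps g (a g i)) -> ut_eval a f = 0.

End Identities.

(* Main.v *)
Require Import Defs.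
From mathcomp Require Import all_boot all_algebra.
From mathcomp.multinomials Require Import monalg.
From mathcomp Require Import finmap.
From Stdlib Require Import Classical_Prop.

(** Call a row [i] complete if every element of [G] is the degree of some
    [e_ij] with [j > i].  A row [i] lying above a complete row [c > i] is itself
    complete: [deg e_ij = deg e_ic * deg e_cj], and left translation by
    [deg e_ic] maps [G] onto [G].  When the grading is not eventually
    incomplete there are complete rows arbitrarily far down, so all rows are
    complete ([not_incomplete_complete]).

    Every sequence of degrees [g_0, g_1, ...] is therefore the degree sequence
    of a path [p_0 < p_1 < ...] in the index set ([complete_path]), and a word
    [m] of length [n] whose letters have degrees [g_0, ..., g_(n-1)] can be read
    along it: send each variable [x] to the sum of the matrix units
    [e_(p_l, p_(l+1))] over the positions [l] at which [x] occurs in [m].  This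
    is a homogeneous substitution, and since the only way to multiply these
    matrix units into [e_(p_0, p_n)] is to walk through the path in order, the
    word [m] takes a value with entry [1] at [(p_0, p_n)], whereas every other
    word has entry [0] there ([entry_path_word]).  So that entry of the value
    of [f] is the coefficient of [m] in [f], and an identity has no nonzero
    coefficient. *)

Set Implicit Arguments.
Unset Strict Implicit.
Unset Printing Implicit Defensive.

Import GRing.Theory.

Local Open Scope ring_scope.

(** * Degrees and paths *)

Section Paths.
Variables (G : groupType) (eps : nat -> G).

(** If row [i] misses the degree [g], then every row [c > i] misses
    [deg(e_ic)^-1 g], which would make the grading eventually incomplete. *)
Lemma not_incomplete_complete :
  ~ eventually_incomplete eps -> forall i g, in_supp_R eps i g.
Proof.
move=> ninc i g; apply: NNPP => nig; apply: ninc; exists i.+1 => c lt_ic suppc.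
have [j lt_cj deg_cj] := suppc ((ut_deg eps i c)^-1 * g)%g.
apply: nig; exists j; first exact: ltn_trans lt_ic lt_cj.
by rewrite -(ut_degM eps (ltnW lt_ic) (ltnW lt_cj)) deg_cj mulVKg.
Qed.

Lemma complete_path (gs : nat -> G) :
    (forall i g, in_supp_R eps i g) ->
  exists p : nat -> nat,
    forall k, (p k < p k.+1)%N /\ ut_deg eps (p k) (p k.+1) = gs k.
Proof.
move=> compl.
have next_ex i g : exists j, (i < j)%N && (ut_deg eps i j == g).
  by have [j lt_ij <-] := compl i g; exists j; rewrite lt_ij eqxx.
pose p := fix p k :=
  if k is k'.+1 then xchoose (next_ex (p k') (gs k')) else 0%N.
by exists p => k; have /andP[lt_p /eqP] := xchooseP (next_ex (p k) (gs k)).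
Qed.

End Paths.

(** * Matrix entries *)

Section Entries.
Variable F : fieldType.
Implicit Types (u v : UT F) (x y : UT1 F).

Definition coord (i j : nat) u : F :=
  if insub (i, j) is Some p then u@_(p : ut_index) else 0.

Lemma coord0 i j : coord i j 0 = 0.
Proof. by rewrite /coord; case: insub => // p; rewrite mcoeff0. Qed.

Lemma coordD i j u v : coord i j (u + v) = coord i j u + coord i j v.
Proof. by rewrite /coord; case: insub => [p|]; rewrite ?mcoeffD ?addr0. Qed.

Lemma coordZ i j c u : coord i j (c *: u) = c * coord i j u.
Proof. by rewrite /coord; case: insub => [p|]; rewrite ?mcoeffZ ?mulr0. Qed.

Lemma coord_unit i j k l : (k <= l)%N ->
  coord i j (ut_unit F k l) = ((i == k) && (j == l))%:R.
Proof.
move=> le_kl; rewrite (ut_unitP F le_kl) /coord; case: insubP => [p _ eq_p|].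
  by rewrite mcoeffU -val_eqE eq_p /= xpair_eqE eq_sym [l == j]eq_sym.
by case: eqP => [->|//] nle; case: eqP => [jl|//]; rewrite jl le_kl in nle.
Qed.

Lemma coord_unit_mul i j k l v : (k <= l)%N ->
  coord i j (ut_mul (ut_unit F k l) v) = (i == k)%:R * coord l j v.
Proof.
move=> le_kl; elim/ut_ind: v => [|u v IHu IHv|c u IH|q].
- by rewrite ut_mul0r !coord0 mulr0.
- by rewrite ut_mulDr !coordD IHu IHv mulrDr.
- by rewrite -ut_scaleAr !coordZ IH mulrCA.
rewrite -ut_unitE; case: q => [[c d] /= le_cd]; rewrite ut_mul_unit //.
rewrite (coord_unit l j le_cd); case: eqP => [eq_lc|_]; last first.
  by rewrite coord0 mulr0.
by rewrite coord_unit -?natrM ?mulnb // (leq_trans le_kl) // eq_lc.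
Qed.

(** The adjoined unit acts as the identity matrix, so a scalar [a] of the
    unitization has the entries of [a] times that matrix. *)
Definition entry (i j : nat) x : F := x.1 * (i == j)%:R + coord i j x.2.

Lemma entry0 i j : entry i j 0 = 0.
Proof. by rewrite /entry /= coord0 mul0r addr0. Qed.

Lemma entryD i j x y : entry i j (x + y) = entry i j x + entry i j y.
Proof. by rewrite /entry /= coordD mulrDl addrACA. Qed.

Lemma entryZ i j c x : entry i j (c *: x) = c * entry i j x.
Proof. by rewrite /entry /= coordZ mulrDr mulrA. Qed.

Lemma entry_sum i j (I : Type) (r : seq I) (P : pred I) (E : I -> UT1 F) :
  entry i j (\sum_(k <- r | P k) E k) = \sum_(k <- r | P k) entry i j (E k).
Proof. exact: (big_morph (entry i j) (entryD i j) (entry0 i j)). Qed.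

Lemma entry1 i j : entry i j 1 = (i == j)%:R.
Proof. by rewrite /entry /= coord0 addr0 mul1r. Qed.

Lemma entry_unit_mul i j k l y : (k <= l)%N ->
  entry i j (ut1_inj (ut_unit F k l) * y) = (i == k)%:R * entry l j y.
Proof.
move=> le_kl; case: y => b v.
have -> : ut1_inj (ut_unit F k l) * ((b, v) : UT1 F) =
    (0 * b, 0 *: v + b *: ut_unit F k l + ut_mul (ut_unit F k l) v) by [].
rewrite /entry /= !mul0r scale0r !add0r coordD coordZ coord_unit //.
by rewrite coord_unit_mul // mulrDr mulrCA -natrM mulnb [l == j]eq_sym.
Qed.

Lemma ut1_inj_sum (I : Type) (r : seq I) (P : pred I) (E : I -> UT F) :
  ut1_inj (\sum_(k <- r | P k) E k) = \sum_(k <- r | P k) ut1_inj (E k).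
Proof.
apply: (big_morph (@ut1_inj F)) => // u v.
by rewrite /ut1_inj; congr pair; rewrite /= addr0.
Qed.

End Entries.

(** * Reading a word along a path *)

Section PathSubstitution.
Variables (F : fieldType) (X : eqType) (p : nat -> nat) (m : seq X).

(** The value of the letter [x] when the [l]-th letter of [m] is made to label
    the step from [p l] to [p l.+1]. *)
Definition path_val (x : X) : UT F :=
  \sum_(l < size m | onth m l == Some x) ut_unit F (p l) (p l.+1).

Hypothesis p_lt : forall k, (p k < p k.+1)%N.

(** Walking along the path, a letter is usable at [p k] only if it is the [k]-th
    letter of [m], and then it leads to [p k.+1]; the word must also end
    exactly when the path does.  The induction needs all the starting points
    [p k], and so all the suffixes of [m]. *)
Lemma entry_path_word (w : seq X) (k : nat) : (k <= size m)%N ->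
  entry (p k) (p (size m)) (\prod_(x <- w) ut1_inj (path_val x))
    = (w == drop k m)%:R.
Proof.
have p_inj : injective p.
  apply/incn_inj/leq_mono => i j; exact: (homo_ltn ltn_trans p_lt).
elim: w k => [|x w IHw] k le_km.
  rewrite big_nil entry1 (inj_eq p_inj).
  rewrite eq_sym [[::] == _]eq_sym -size_eq0 size_drop subn_eq0.
  by rewrite eqn_leq le_km andbT.
rewrite big_cons; set y := \prod_(_ <- w) _ in IHw *.
rewrite ut1_inj_sum mulr_suml entry_sum.
under eq_bigr => l _.
  rewrite entry_unit_mul 1?ltnW // (inj_eq p_inj) IHw ?ltn_ord //.
  over.
rewrite big_mkcond /=; case: ltngtP le_km => // [lt_km _|->]; last first.
  rewrite drop_size big1 // => l _; case: ifP => // _.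
  by rewrite eq_sym (ltn_eqF (ltn_ord l)) mul0r.
(* Only the step leaving [p k] contributes, as [p] is injective. *)
rewrite (bigD1 (Ordinal lt_km)) //= eqxx mul1r big1 ?addr0 => [|l ne_lk].
  rewrite onthE (nth_map x) // [in RHS](drop_nth x) // eqseq_cons.
  rewrite -[Some _ == _]/(nth x m k == x) [x == _]eq_sym.
  by case: eqP.
case: ifP => // _; case: eqP => [eq_kl|_]; last by rewrite mul0r.
by case/eqP: ne_lk; apply: val_inj.
Qed.

End PathSubstitution.

(** * Homogeneous substitutions and graded identities *)

Section Homogeneous.
Variables (F : fieldType) (G : groupType) (eps : nat -> G).

Lemma ut_homog_sum g (I : Type) (r : seq I) (P : pred I) (E : I -> UT F) :
    (forall k, P k -> ut_homog eps g (E k)) ->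
  ut_homog eps g (\sum_(k <- r | P k) E k).
Proof.
move=> homE; elim/big_ind: _ => // [q|u v homu homv q]; first by rewrite msupp0.
by move/(fsubsetP (msuppD_le u v)); rewrite in_fsetU => /orP[/homu|/homv].
Qed.

Lemma path_val_homog (p : nat -> nat) (m : seq (G * nat)) g i :
    (forall l x, onth m l = Some x -> ut_deg eps (p l) (p l.+1) = x.1) ->
  ut_homog eps g (path_val F p m (g, i)).
Proof.
move=> deg_p; apply: ut_homog_sum => l /eqP /deg_p /= <-.
exact: ut_homog_unit.
Qed.

End Homogeneous.

Theorem proposition4p9 (F : fieldType) (G : groupType) (eps : nat -> G) :
  ~ eventually_incomplete eps ->
  forall f : free_algebra F G, graded_identity eps f <-> f = 0%R.
Proof.
move=> /not_incomplete_complete compl f; split=> [idf|-> a _]; last first.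
  by rewrite /ut_eval mmapE msupp0 big_seq_fset0.
apply/malgP => m; rewrite mcoeff0.
(* The default degree [1] only concerns the steps beyond the end of [m]. *)
have [p p_path] := complete_path (fun k => nth 1%g [seq x.1 | x <- m] k) compl.
have p_lt k : (p k < p k.+1)%N by case: (p_path k).
pose a g i := path_val F p m (g, i).
have /(congr1 (entry (p 0%N) (p (size m)))) : ut_eval a f = 0.
  apply: idf => g i; apply: path_val_homog => l x m_l.
  have [_ ->] := p_path l.
  by apply: onth_nth; rewrite onth_map m_l.
rewrite entry0 /ut_eval mmapE entry_sum => <-.
rewrite [in LHS](monalgE f) raddf_sum; apply: eq_bigr => w _.
have -> : \prod_(x <- w) ut1_inj (a x.1 x.2)
        = \prod_(x <- w) ut1_inj (path_val F p m x).
  by apply: eq_bigr => -[].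
by rewrite mulr_algl entryZ entry_path_word // drop0 /= mcoeffU mulr_natr.
Qed.
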